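(* For each real number $A$ there exists a unique function $f:[0,1]\to\mathbb{R}$ satisfying $$f'(x)=\begin{cases}2f(2x) & 0\le x\le 1/2\\ 2f(2-2x) & 1/2<x\le 1\end{cases}$$ on $[0,1]$, together with $f(0)=0$ and $\displaystyle\int_0^1 f(x)\,dx=A$.
   Context: A solution over $[0,1]$ is a function $f:[0,1]\to\mathbb{R}$, differentiable on $[0,1]$ (with one-sided derivatives at the endpoints $0$ and $1$), satisfying the displayed equation for all $x\in[0,1]$. *)

(* Defs.v *)
From Stdlib Require Import Reals.
From Coquelicot Require Import Coquelicot.
Open Scope R_scope.

(* A function [0,1] -> R is represented by a total function R -> R, of which
   only the values on [0,1] matter; two such functions are identified when they
   agree on this set. *)
Definition unit_interval (x : R) : Prop := 0 <= x <= 1.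

Definition tent_rhs (f : R -> R) (x : R) : R :=
  if Rle_dec x (1 / 2) then 2 * f (2 * x) else 2 * f (2 - 2 * x).

(* [D_in f d D x] takes the limit of the difference quotient along the points of
   D other than x: it is the two-sided derivative for 0 < x < 1 and the
   one-sided derivative at 0 and at 1. *)
Definition is_solution (f : R -> R) : Prop :=
  forall x : R, unit_interval x -> D_in f (tent_rhs f) unit_interval x.

(* Main.v *)
(** Integrating the equation turns a solution with [f 0 = 0] and integral [A]
    into a fixed point of [T f x = int_0^x 2 f (t s) ds], where
    [t s = 1 - |2 s - 1|] is the tent map.  By substitution, [T u x] is
    [int_0^{2x} u] on the left half and [int_0^1 u + int_{2-2x}^1 u] on the
    right half.  If [|u| <= M] and [int_0^1 u = 0], then [|int_0^y u|] is at most
    [M y] and at most [M (1 - y)], hence at most [M / 2]: so [T] contracts by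
    [1/2] on the continuous functions of prescribed integral, a set it maps to
    itself because [T u s + T u (1 - s) = 2 int_0^1 u]. *)

Require Import Defs.
From Stdlib Require Import Reals Lra Lia.
From Coquelicot Require Import Coquelicot.
Open Scope R_scope.

(** * Integrals, continuity and geometric bounds *)

Lemma ex_RInt_cont (f : R -> R) (a b : R) :
  (forall x, continuous f x) -> ex_RInt f a b.
Proof. intros Hf; apply (@ex_RInt_continuous R_CompleteNormedModule); auto. Qed.

Lemma RInt_Rconst (a b c : R) : RInt (fun _ => c) a b = (b - a) * c.
Proof. exact (RInt_const (V := R_CompleteNormedModule) a b c). Qed.

Lemma continuous_affine (u v x : R) : continuous (fun s : R => u * s + v) x.
Proof.
apply (@ex_derive_continuous R_AbsRing R_NormedModule); auto_derive; auto.
Qed.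

Lemma pow_half_small (K eps : R) :
  0 < eps -> exists N, forall n, (N <= n)%nat -> K * (1 / 2) ^ n < eps.
Proof.
intros Heps.
assert (L : is_lim_seq (fun n => K * (1 / 2) ^ n) 0).
{ replace (Finite 0) with (Rbar_mult K 0) by (simpl; f_equal; ring).
  apply is_lim_seq_scal_l, is_lim_seq_geom.
  rewrite Rabs_pos_eq; lra. }
apply is_lim_seq_spec in L.
destruct (L (mkposreal eps Heps)) as [N HN].
exists N; intros n Hn; specialize (HN n Hn); simpl in HN.
rewrite Rminus_0_r in HN.
apply Rle_lt_trans with (2 := HN), Rle_abs.
Qed.

(** Uniqueness, the integral of the limit and its fixed-point equation are each reduced to this. *)
Lemma eq_0_of_geometric_bound (a K : R) :
  (forall n, Rabs a <= K * (1 / 2) ^ n) -> a = 0.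
Proof.
intros H.
destruct (Req_dec a 0) as [|Ha]; auto.
destruct (pow_half_small K (Rabs a) (Rabs_pos_lt a Ha)) as [N HN].
specialize (H N); specialize (HN N (le_n N)); lra.
Qed.

Lemma RInt_minus_eq_0 (f g : R -> R) :
  (forall x, continuous f x) -> (forall x, continuous g x) ->
  RInt f 0 1 = RInt g 0 1 -> RInt (fun x => f x - g x) 0 1 = 0.
Proof.
intros Hf Hg HI.
rewrite (RInt_minus (V := R_CompleteNormedModule) f g) by now apply ex_RInt_cont.
rewrite HI; apply (minus_eq_zero (G := R_AbelianGroup)).
Qed.

Lemma continuous_Rminus (f g : R -> R) :
  (forall x, continuous f x) -> (forall x, continuous g x) ->
  forall x, continuous (fun y => f y - g y) x.
Proof.
intros Hf Hg x.
apply (@continuous_minus R_UniformSpace R_AbsRing R_NormedModule f g); auto.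
Qed.

(** * Retraction of the line onto [[0,1]] *)

(** Composing with this retraction extends a function continuous on [[0,1]] to one continuous on the
    whole line, so that global continuity can be assumed throughout, without endpoint cases. *)
Definition clamp (x : R) : R := (1 + Rabs x - Rabs (x - 1)) / 2.

Lemma clamp_id (x : R) : unit_interval x -> clamp x = x.
Proof.
intros [H0 H1]; unfold clamp.
rewrite (Rabs_pos_eq x), (Rabs_left1 (x - 1)); lra.
Qed.

Lemma clamp_unit (x : R) : unit_interval (clamp x).
Proof.
unfold unit_interval, clamp, Rabs; destruct (Rcase_abs x), (Rcase_abs (x - 1)); lra.
Qed.

Lemma clamp_lipschitz (x y : R) : Rabs (clamp x - clamp y) <= Rabs (x - y).
Proof.
unfold clamp, Rabs.
repeat (match goal with |- context [Rcase_abs ?z] => destruct (Rcase_abs z) end; try lra).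
Qed.

Lemma continuous_clamp (x : R) : continuous clamp x.
Proof.
apply continuity_pt_filterlim; intros eps Heps.
exists eps; split; auto; intros y [_ Hy].
apply Rle_lt_trans with (2 := Hy), clamp_lipschitz.
Qed.

Lemma continuous_comp_clamp (f : R -> R) :
  (forall x, continuous f x) -> forall x, continuous (fun y => f (clamp y)) x.
Proof.
intros Hf x; apply (continuous_comp clamp f); [apply continuous_clamp | apply Hf].
Qed.

(** * The tent map and its integral operator *)

Definition tent (s : R) : R := 1 - Rabs (2 * s - 1).

(** The [+ 0] gives the shape [u * s + v] of the linear substitution [RInt_comp_lin]. *)
Lemma tent_left (s : R) : s <= 1 / 2 -> tent s = 2 * s + 0.
Proof. intros Hs; unfold tent; rewrite Rabs_left1; lra. Qed.

Lemma tent_right (s : R) : 1 / 2 <= s -> tent s = - 2 * s + 2.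
Proof. intros Hs; unfold tent; rewrite Rabs_pos_eq; lra. Qed.

Lemma tent_rhs_tent (f : R -> R) (x : R) : tent_rhs f x = 2 * f (tent x).
Proof.
unfold tent_rhs; destruct (Rle_dec x (1 / 2)).
- rewrite tent_left by lra; do 2 f_equal; ring.
- rewrite tent_right by lra; do 2 f_equal; ring.
Qed.

Lemma tent_unit (s : R) : unit_interval s -> unit_interval (tent s).
Proof.
unfold unit_interval; intros [H0 H1]; destruct (Rle_dec s (1 / 2)).
- rewrite tent_left; lra.
- rewrite tent_right; lra.
Qed.

Lemma continuous_tent (x : R) : continuous tent x.
Proof.
apply (@continuous_minus R_UniformSpace R_AbsRing R_NormedModule).
- apply continuous_const.
- apply (continuous_Rabs_comp (fun s => 2 * s + - (1))), continuous_affine.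
Qed.

Lemma continuous_scal_comp_tent (f : R -> R) :
  (forall x, continuous f x) -> forall x, continuous (fun s => 2 * f (tent s)) x.
Proof.
intros Hf x.
apply (continuous_scal_r 2 (fun s => f (tent s))).
apply (continuous_comp tent f); [apply continuous_tent | apply Hf].
Qed.

(** The operator [T]. For continuous [f] the integrand is a single continuous function, so the
    fundamental theorem of calculus gives the derivative without splitting at [1 / 2]. *)
Definition tent_int (f : R -> R) (x : R) : R :=
  RInt (fun s => 2 * f (tent s)) 0 x.

Lemma is_derive_tent_int (f : R -> R) (x : R) :
  (forall x, continuous f x) -> is_derive (tent_int f) x (2 * f (tent x)).
Proof.
intros Hf.
assert (Hg := continuous_scal_comp_tent f Hf).
apply (is_derive_RInt (fun s => 2 * f (tent s)) (tent_int f) 0 x); [|apply Hg].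
apply filter_forall; intros y.
apply (RInt_correct (V := R_CompleteNormedModule)), ex_RInt_cont, Hg.
Qed.

Lemma continuous_tent_int (f : R -> R) :
  (forall x, continuous f x) -> forall x, continuous (tent_int f) x.
Proof.
intros Hf x.
apply (@ex_derive_continuous R_AbsRing R_NormedModule).
eexists; apply is_derive_tent_int, Hf.
Qed.

Lemma tent_int_left (f : R -> R) (x : R) :
  (forall x, continuous f x) -> x <= 1 / 2 -> tent_int f x = RInt f 0 (2 * x).
Proof.
intros Hf Hx; unfold tent_int.
replace (RInt f 0 (2 * x)) with (RInt f (2 * 0 + 0) (2 * x + 0)) by (f_equal; ring).
rewrite <- (RInt_comp_lin (V := R_CompleteNormedModule)) by now apply ex_RInt_cont.
apply (RInt_ext (V := R_CompleteNormedModule)); intros s Hs.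
(* [x] may be negative, so [s] is bounded above by [Rmax 0 x] rather than by [x]. *)
assert (Rmax 0 x <= 1 / 2) by (apply Rmax_lub; lra).
rewrite tent_left by lra; reflexivity.
Qed.

Lemma tent_int_right (f : R -> R) (x : R) :
  (forall x, continuous f x) -> 1 / 2 <= x ->
  tent_int f x = RInt f 0 1 + RInt f (2 - 2 * x) 1.
Proof.
intros Hf Hx.
assert (Hg := continuous_scal_comp_tent f Hf).
unfold tent_int.
rewrite <- (RInt_Chasles (V := R_CompleteNormedModule) _ 0 (1 / 2) x)
  by now apply ex_RInt_cont.
apply f_equal2.
- fold (tent_int f (1 / 2)); rewrite tent_int_left by (auto; lra).
  f_equal; lra.
(* The slope [-2] reverses orientation: the substitution yields the integral from [1] to
   [2 - 2 * x], whose sign is then absorbed into the integrand. *)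
- rewrite <- (opp_RInt_swap (V := R_CompleteNormedModule) f 1) by now apply ex_RInt_cont.
  replace (RInt f 1 (2 - 2 * x)) with (RInt f (- 2 * (1 / 2) + 2) (- 2 * x + 2))
    by (f_equal; lra).
  rewrite <- (RInt_comp_lin (V := R_CompleteNormedModule)) by now apply ex_RInt_cont.
  rewrite <- (RInt_opp (V := R_CompleteNormedModule)).
  2:{ apply ex_RInt_cont; intros y.
      apply (continuous_scal_r (-2) (fun s => f (-2 * s + 2))).
      apply (continuous_comp (fun s => -2 * s + 2) f); [apply continuous_affine | apply Hf]. }
  apply (RInt_ext (V := R_CompleteNormedModule)); intros s Hs.
  rewrite Rmin_left in Hs by lra.
  rewrite tent_right by lra.
  unfold opp, scal; simpl; unfold mult; simpl; ring.
Qed.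

(** For [x <= 1 / 2] the terms are the integral over [[0, 2x]] and the full integral plus the one
    over [[2x, 1]]; the two partial integrals join up. The claim is invariant under [x -> 1 - x],
    which covers the other half. *)
Lemma tent_int_symmetric (f : R -> R) (x : R) :
  (forall x, continuous f x) -> tent_int f x + tent_int f (1 - x) = 2 * RInt f 0 1.
Proof.
intros Hf.
assert (E : forall y, y <= 1 / 2 -> tent_int f y + tent_int f (1 - y) = 2 * RInt f 0 1).
{ intros y Hy.
  rewrite tent_int_left, tent_int_right by (auto; lra).
  replace (2 - 2 * (1 - y)) with (2 * y) by ring.
  rewrite <- (RInt_Chasles (V := R_CompleteNormedModule) f 0 (2 * y) 1)
    by now apply ex_RInt_cont.
  unfold plus; simpl; ring. }
destruct (Rle_dec x (1 / 2)) as [Hx|Hx]; [now apply E|].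
rewrite <- (E (1 - x)) by lra.
replace (1 - (1 - x)) with x by ring; ring.
Qed.

(** Integrate [tent_int_symmetric] over [[0,1]]: the reflection [s -> 1 - s] preserves the integral,
    so both summands contribute equally. *)
Lemma RInt_tent_int (f : R -> R) :
  (forall x, continuous f x) -> RInt (tent_int f) 0 1 = RInt f 0 1.
Proof.
intros Hf.
assert (HT := continuous_tent_int f Hf).
assert (HT' : forall x, continuous (fun s => tent_int f (1 - s)) x).
{ intros x; apply (continuous_comp (fun s => 1 - s) (tent_int f)); [|apply HT].
  apply continuous_ext with (fun s => -1 * s + 1); [|apply continuous_affine].
  intros s; change (-1 * s + 1 = 1 - s :> R); ring. }
assert (E : RInt (fun s => tent_int f (1 - s)) 0 1 = RInt (tent_int f) 0 1).
{ rewrite <- (opp_RInt_swap (V := R_CompleteNormedModule) (tent_int f) 1)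
    by now apply ex_RInt_cont.
  replace (RInt (tent_int f) 1 0) with (RInt (tent_int f) (-1 * 0 + 1) (-1 * 1 + 1))
    by (f_equal; ring).
  rewrite <- (RInt_comp_lin (V := R_CompleteNormedModule)) by now apply ex_RInt_cont.
  rewrite <- (RInt_opp (V := R_CompleteNormedModule)).
  2:{ apply ex_RInt_cont; intros y.
      apply (continuous_scal_r (-1) (fun s => tent_int f (-1 * s + 1))).
      apply (continuous_comp (fun s => -1 * s + 1) (tent_int f));
        [apply continuous_affine | apply HT]. }
  apply (RInt_ext (V := R_CompleteNormedModule)); intros s _.
  unfold opp, scal; simpl; unfold mult; simpl.
  replace (1 - s) with (-1 * s + 1) by ring.
  ring. }
assert (S : RInt (fun s => plus (tent_int f s) (tent_int f (1 - s))) 0 1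
            = 2 * RInt f 0 1).
{ rewrite (RInt_ext (V := R_CompleteNormedModule) _ (fun _ => 2 * RInt f 0 1)).
  - rewrite RInt_Rconst; lra.
  - intros s _; apply tent_int_symmetric, Hf. }
rewrite (RInt_plus (V := R_CompleteNormedModule)) in S by now apply ex_RInt_cont.
unfold plus in S; simpl in S; lra.
Qed.

Lemma tent_int_minus (f g : R -> R) (x : R) :
  (forall x, continuous f x) -> (forall x, continuous g x) ->
  tent_int (fun y => f y - g y) x = tent_int f x - tent_int g x.
Proof.
intros Hf Hg; unfold tent_int.
rewrite (RInt_ext (V := R_CompleteNormedModule) _
  (fun s => minus (2 * f (tent s)) (2 * g (tent s)))).
- apply (RInt_minus (V := R_CompleteNormedModule));
    apply ex_RInt_cont; now apply continuous_scal_comp_tent.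
- intros s _; unfold minus, plus, opp; simpl; ring.
Qed.

(** * Contraction and uniqueness of the fixed point *)

Lemma Rabs_RInt_le_half (u : R -> R) (M y : R) :
  (forall x, continuous u x) -> RInt u 0 1 = 0 ->
  (forall x, unit_interval x -> Rabs (u x) <= M) ->
  unit_interval y -> Rabs (RInt u 0 y) <= M / 2 /\ Rabs (RInt u y 1) <= M / 2.
Proof.
intros Hu H0 HM [Hy0 Hy1].
assert (HMpos : 0 <= M).
{ apply Rle_trans with (2 := HM 0 ltac:(unfold unit_interval; lra)), Rabs_pos. }
assert (B1 : Rabs (RInt u 0 y) <= (y - 0) * M).
{ apply abs_RInt_le_const; auto using ex_RInt_cont.
  intros t Ht; apply HM; unfold unit_interval; lra. }
assert (B2 : Rabs (RInt u y 1) <= (1 - y) * M).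
{ apply abs_RInt_le_const; auto using ex_RInt_cont.
  intros t Ht; apply HM; unfold unit_interval; lra. }
assert (C := RInt_Chasles (V := R_CompleteNormedModule) u 0 y 1
               (ex_RInt_cont u _ _ Hu) (ex_RInt_cont u _ _ Hu)).
rewrite H0 in C; unfold plus in C; simpl in C.
(* The two pieces are opposite, so each satisfies both bounds, and the smaller of [y] and [1 - y] is
   at most [1 / 2]. *)
assert (E : RInt u y 1 = - RInt u 0 y) by lra.
rewrite E, Rabs_Ropp in *.
destruct (Rle_dec y (1 / 2)); split; nra.
Qed.

Lemma tent_int_contracting (u : R -> R) (M x : R) :
  (forall x, continuous u x) -> RInt u 0 1 = 0 ->
  (forall x, unit_interval x -> Rabs (u x) <= M) ->
  unit_interval x -> Rabs (tent_int u x) <= M / 2.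
Proof.
intros Hu H0 HM [Hx0 Hx1].
destruct (Rle_dec x (1 / 2)) as [Hx|Hx].
- rewrite tent_int_left by auto.
  apply Rabs_RInt_le_half; auto; unfold unit_interval; lra.
- rewrite tent_int_right, H0, Rplus_0_l by (auto; lra).
  apply Rabs_RInt_le_half; auto; unfold unit_interval; lra.
Qed.

(** The difference [u] is itself fixed and has integral zero, so [n] contractions bound it by its
    maximum, attained at [m], times [(1 / 2) ^ n]. *)
Lemma tent_int_fixed_point_unique (f g : R -> R) :
  (forall x, continuous f x) -> (forall x, continuous g x) ->
  RInt f 0 1 = RInt g 0 1 ->
  (forall x, unit_interval x -> f x = tent_int f x) ->
  (forall x, unit_interval x -> g x = tent_int g x) ->
  forall x, unit_interval x -> f x = g x.
Proof.
intros Hf Hg HI Ff Fg.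
set (u := fun x => f x - g x).
assert (Hu : forall x, continuous u x).
{ now apply continuous_Rminus. }
assert (H0 : RInt u 0 1 = 0) by now apply RInt_minus_eq_0.
destruct (continuity_ab_maj (fun x => Rabs (u x)) 0 1) as [m [Hm _]]; [lra | |].
{ intros c _; apply continuity_pt_filterlim, (continuous_Rabs_comp u), Hu. }
assert (B : forall n x, unit_interval x -> Rabs (u x) <= Rabs (u m) * (1 / 2) ^ n).
{ induction n as [|n IH]; intros x Hx.
  - rewrite pow_O, Rmult_1_r; apply Hm, Hx.
  - replace (u x) with (tent_int u x).
    + simpl; replace (Rabs (u m) * (1 / 2 * (1 / 2) ^ n))
        with (Rabs (u m) * (1 / 2) ^ n / 2) by field.
      now apply tent_int_contracting.
    + unfold u at 2; rewrite Ff, Fg by auto; now apply tent_int_minus. }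
intros x Hx; apply Rminus_diag_uniq, (eq_0_of_geometric_bound (u x) (Rabs (u m))).
intros n; now apply B.
Qed.

(** * Existence: iterates and their uniform limit *)

(** Picard iteration from the constant [A], which already has integral [A]. Clamping the argument
    makes the estimates below hold uniformly on the whole line. *)
Fixpoint tent_iter (A : R) (n : nat) : R -> R :=
  match n with
  | O => fun _ => A
  | S n => fun x => tent_int (tent_iter A n) (clamp x)
  end.

Lemma continuous_tent_iter (A : R) (n : nat) (x : R) : continuous (tent_iter A n) x.
Proof.
revert x; induction n as [|n IH]; simpl; intros x.
- apply continuous_const.
- now apply (continuous_comp_clamp (tent_int (tent_iter A n))), continuous_tent_int.
Qed.

Lemma RInt_comp_clamp (f : R -> R) : RInt (fun x => f (clamp x)) 0 1 = RInt f 0 1.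
Proof.
apply (RInt_ext (V := R_CompleteNormedModule)); intros x.
rewrite Rmin_left, Rmax_right by lra; intros Hx.
rewrite clamp_id; auto; unfold unit_interval; lra.
Qed.

Lemma RInt_tent_iter (A : R) (n : nat) : RInt (tent_iter A n) 0 1 = A.
Proof.
induction n as [|n IH]; simpl.
- rewrite RInt_Rconst; ring.
- rewrite RInt_comp_clamp, RInt_tent_int; auto using continuous_tent_iter.
Qed.

Lemma tent_iter_step (A : R) (n : nat) (x : R) :
  Rabs (tent_iter A (S n) x - tent_iter A n x) <= Rabs A * (1 / 2) ^ n.
Proof.
revert x; induction n as [|n IH]; intros x.
- simpl; unfold tent_int; rewrite RInt_Rconst.
  (* The first iterate is [2 * A * clamp x], and [2 * clamp x - 1] lies in [[-1,1]]. *)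
  replace ((clamp x - 0) * (2 * A) - A) with (A * (2 * clamp x - 1)) by ring.
  rewrite Rabs_mult.
  apply Rmult_le_compat_l; [apply Rabs_pos|].
  destruct (clamp_unit x); apply Rabs_le; lra.
- change (tent_iter A (S (S n)) x) with (tent_int (tent_iter A (S n)) (clamp x)).
  change (tent_iter A (S n) x) with (tent_int (tent_iter A n) (clamp x)).
  rewrite <- tent_int_minus by apply continuous_tent_iter.
  simpl pow; replace (Rabs A * (1 / 2 * (1 / 2) ^ n))
    with (Rabs A * (1 / 2) ^ n / 2) by field.
  apply tent_int_contracting.
  + apply continuous_Rminus; apply continuous_tent_iter.
  + apply RInt_minus_eq_0; try apply continuous_tent_iter.
    now rewrite !RInt_tent_iter.
  + intros y _; apply IH.
  + apply clamp_unit.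
Qed.

(** Telescoping sum of the steps. Keeping the subtracted power makes the induction exact; dropping
    it later gives a bound independent of [k]. *)
Lemma tent_iter_cauchy (A : R) (n k : nat) (x : R) :
  Rabs (tent_iter A (n + k) x - tent_iter A n x)
  <= 2 * Rabs A * ((1 / 2) ^ n - (1 / 2) ^ (n + k)).
Proof.
induction k as [|k IH].
- rewrite Nat.add_0_r, !Rminus_diag, Rabs_R0; lra.
- rewrite Nat.add_succ_r.
  pose proof (tent_iter_step A (n + k) x) as Hs.
  pose proof (Rabs_triang (tent_iter A (S (n + k)) x - tent_iter A (n + k) x)
                (tent_iter A (n + k) x - tent_iter A n x)) as Ht.
  replace (tent_iter A (S (n + k)) x - tent_iter A (n + k) x
           + (tent_iter A (n + k) x - tent_iter A n x))
    with (tent_iter A (S (n + k)) x - tent_iter A n x) in Ht by ring.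
  simpl pow; lra.
Qed.

(** [real] would send an infinite limit to 0; [is_lim_tent_iter] shows that the limit is finite. *)
Definition tent_limit (A x : R) : R := real (Lim_seq (fun n => tent_iter A n x)).

Lemma is_lim_tent_iter (A x : R) :
  is_lim_seq (fun n => tent_iter A n x) (tent_limit A x).
Proof.
apply Lim_seq_correct', ex_lim_seq_cauchy_corr.
intros eps.
(* Both terms are compared with iterate [N], at distance at most [2 * Rabs A * (1 / 2) ^ N] each. *)
destruct (pow_half_small (2 * (2 * Rabs A)) eps (cond_pos eps)) as [N HN].
exists N.
assert (C : forall n, (N <= n)%nat ->
          Rabs (tent_iter A n x - tent_iter A N x) <= 2 * Rabs A * (1 / 2) ^ N).
{ intros n Hn.
  replace n with (N + (n - N))%nat by lia.
  apply Rle_trans with (1 := tent_iter_cauchy A N (n - N) x).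
  apply Rmult_le_compat_l; [pose proof (Rabs_pos A); lra|].
  pose proof (pow_le (1 / 2) (N + (n - N)) ltac:(lra)); lra. }
intros n m Hn Hm.
specialize (HN N (le_n N)).
pose proof (C n Hn) as Cn.
pose proof (C m Hm) as Cm; rewrite Rabs_minus_sym in Cm.
pose proof (Rabs_triang (tent_iter A n x - tent_iter A N x)
              (tent_iter A N x - tent_iter A m x)) as Ht.
replace (tent_iter A n x - tent_iter A N x + (tent_iter A N x - tent_iter A m x))
  with (tent_iter A n x - tent_iter A m x) in Ht by ring.
lra.
Qed.

(** Let [k] tend to infinity in [tent_iter_cauchy]. The bound is uniform in [x], hence continuity
    and the integral pass to the limit. *)
Lemma tent_limit_dist (A x : R) (n : nat) :
  Rabs (tent_limit A x - tent_iter A n x) <= 2 * Rabs A * (1 / 2) ^ n.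
Proof.
assert (L : is_lim_seq (fun k => Rabs (tent_iter A (k + n) x - tent_iter A n x))
              (Rabs (tent_limit A x - tent_iter A n x))).
{ apply (is_lim_seq_abs _ (Finite (tent_limit A x - tent_iter A n x))).
  apply is_lim_seq_minus'; [|apply is_lim_seq_const].
  apply (is_lim_seq_incr_n (fun k => tent_iter A k x)), is_lim_tent_iter. }
refine (is_lim_seq_le _ _ _ (Finite _) _ L (is_lim_seq_const _)).
intros k; rewrite Nat.add_comm.
apply Rle_trans with (1 := tent_iter_cauchy A n k x).
apply Rmult_le_compat_l; [pose proof (Rabs_pos A); lra|].
pose proof (pow_le (1 / 2) (n + k) ltac:(lra)); lra.
Qed.

Lemma continuous_tent_limit (A x : R) : continuous (tent_limit A) x.
Proof.
apply continuity_pt_filterlim.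
apply (CVU_continuity (tent_iter A) (tent_limit A) x (mkposreal 1 Rlt_0_1)).
- intros eps Heps.
  destruct (pow_half_small (2 * Rabs A) eps Heps) as [N HN].
  exists N; intros n y Hn _.
  apply Rle_lt_trans with (1 := tent_limit_dist A y n), HN, Hn.
- intros n y _; apply continuity_pt_filterlim, continuous_tent_iter.
- unfold Boule; simpl; rewrite Rminus_diag, Rabs_R0; lra.
Qed.

Lemma RInt_tent_limit (A : R) : RInt (tent_limit A) 0 1 = A.
Proof.
apply Rminus_diag_uniq, (eq_0_of_geometric_bound _ (2 * Rabs A)); intros n.
rewrite <- (RInt_tent_iter A n) at 2.
change (RInt (tent_limit A) 0 1 - RInt (tent_iter A n) 0 1)
  with (minus (RInt (tent_limit A) 0 1) (RInt (tent_iter A n) 0 1)).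
rewrite <- (RInt_minus (V := R_CompleteNormedModule) (tent_limit A) (tent_iter A n) 0 1)
  by (apply ex_RInt_cont; auto using continuous_tent_limit, continuous_tent_iter).
replace (2 * Rabs A * (1 / 2) ^ n) with ((1 - 0) * (2 * Rabs A * (1 / 2) ^ n)) by ring.
apply abs_RInt_le_const; [lra | |].
- apply ex_RInt_cont, continuous_Rminus;
    auto using continuous_tent_limit, continuous_tent_iter.
- intros t _; apply tent_limit_dist.
Qed.

(** Both sides are compared with iterate [n + 1]: each lies within [Rabs A * (1 / 2) ^ n] of it, on
    the right by contraction. *)
Lemma tent_limit_fixed (A x : R) :
  unit_interval x -> tent_limit A x = tent_int (tent_limit A) x.
Proof.
intros Hx.
apply Rminus_diag_uniq, (eq_0_of_geometric_bound _ (2 * Rabs A)); intros n.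
pose proof (tent_limit_dist A x (S n)) as D.
simpl in D; rewrite (clamp_id x Hx) in D.
assert (C : Rabs (tent_int (fun y => tent_limit A y - tent_iter A n y) x)
            <= 2 * Rabs A * (1 / 2) ^ n / 2).
{ apply tent_int_contracting; auto.
  - apply continuous_Rminus; auto using continuous_tent_limit, continuous_tent_iter.
  - apply RInt_minus_eq_0; auto using continuous_tent_limit, continuous_tent_iter.
    now rewrite RInt_tent_limit, RInt_tent_iter.
  - intros y _; apply tent_limit_dist. }
rewrite tent_int_minus in C by auto using continuous_tent_limit, continuous_tent_iter.
rewrite Rabs_minus_sym in C.
pose proof (Rabs_triang (tent_limit A x - tent_int (tent_iter A n) x)
  (tent_int (tent_iter A n) x - tent_int (tent_limit A) x)) as Ht.
replace (tent_limit A x - tent_int (tent_iter A n) x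
  + (tent_int (tent_iter A n) x - tent_int (tent_limit A) x))
  with (tent_limit A x - tent_int (tent_limit A) x) in Ht by ring.
lra.
Qed.

(** * Correspondence between solutions and fixed points *)

(** Difference quotients along [D] see only values on [D], so the one-sided derivatives at 0 and 1
    come from a two-sided derivative of an extension. *)
Lemma is_derive_D_in (f g d : R -> R) (D : R -> Prop) (x : R) :
  is_derive g x (d x) -> (forall y, D y -> f y = g y) -> D x -> D_in f d D x.
Proof.
intros Hg E Dx eps Heps.
apply is_derive_Reals in Hg.
destruct (Hg eps Heps) as [delta Hd].
exists delta; split; [apply cond_pos|].
intros y [[Dy Hne] Hy]; simpl in *; unfold Rdist in *.
specialize (Hd (y - x) ltac:(lra) Hy).
replace (x + (y - x)) with y in Hd by ring.
now rewrite !E.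
Qed.

Lemma tent_int_fixed_is_solution (f : R -> R) :
  (forall x, continuous f x) ->
  (forall x, unit_interval x -> f x = tent_int f x) -> is_solution f.
Proof.
intros Hf Ff x Hx.
apply is_derive_D_in with (tent_int f); auto.
rewrite tent_rhs_tent; now apply is_derive_tent_int.
Qed.

Lemma is_solution_continuous (g : R -> R) :
  is_solution g -> forall x, continuous (fun y => g (clamp y)) x.
Proof.
intros Hg x.
assert (C := cont_deriv _ _ _ _ (Hg (clamp x) (clamp_unit x))).
apply continuity_pt_filterlim; intros eps Heps.
destruct (C eps Heps) as [delta [Hd C']].
exists delta; split; auto; intros y [_ Hy].
simpl in *; unfold Rdist in *.
(* The limit along [unit_interval] excludes the base point, which distinct [x] and [y] can share
   after clamping. *)
destruct (Req_dec (clamp x) (clamp y)) as [->|Hne].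
- rewrite Rminus_diag, Rabs_R0; lra.
- apply C'; split; [split; auto using clamp_unit|].
  apply Rle_lt_trans with (2 := Hy), clamp_lipschitz.
Qed.

Lemma is_solution_is_derive (g : R -> R) (x : R) :
  is_solution g -> 0 < x < 1 ->
  is_derive (fun y => g (clamp y)) x (2 * g (clamp (tent x))).
Proof.
intros Hg Hx.
assert (Ux : unit_interval x) by (unfold unit_interval; lra).
rewrite (clamp_id (tent x)) by now apply tent_unit.
rewrite <- tent_rhs_tent.
apply is_derive_Reals; intros eps Heps.
destruct (Hg x Ux eps Heps) as [alp [Ha H]].
(* Besides [alp], the radius is limited by [x] and [1 - x] so that [x + h] stays where [clamp] is
   the identity. *)
assert (Hm : 0 < Rmin alp (Rmin x (1 - x))) by (repeat apply Rmin_pos; lra).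
exists (mkposreal _ Hm); intros h Hh Hlt; simpl in Hlt.
pose proof (Rmin_l alp (Rmin x (1 - x))).
pose proof (Rmin_r alp (Rmin x (1 - x))).
pose proof (Rmin_l x (1 - x)).
pose proof (Rmin_r x (1 - x)).
assert (Hh2 := Rabs_def2 _ _ Hlt).
assert (Uy : unit_interval (x + h)) by (unfold unit_interval; lra).
rewrite !clamp_id by auto.
specialize (H (x + h)); simpl in H; unfold Rdist in H.
replace (x + h - x) with h in H by ring.
apply H; split; [split; [auto | lra] | lra].
Qed.

(** The difference of the two sides vanishes at 0 and has zero derivative on [(0,1)]. The mean value
    theorem needs only continuity at the endpoints, where the clamped function may have a corner. *)
Lemma is_solution_fixed (g : R -> R) :
  is_solution g -> g 0 = 0 ->
  forall x, unit_interval x -> g (clamp x) = tent_int (fun y => g (clamp y)) x.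
Proof.
intros Hg H0 x Hx.
set (gc := fun y => g (clamp y)).
assert (Hc : forall x, continuous gc x) by now apply is_solution_continuous.
destruct (MVT_gen (fun y => gc y - tent_int gc y) 0 x (fun _ => 0)) as [c [_ E]].
- rewrite Rmin_left, Rmax_right by apply Hx; intros y Hy.
  replace 0 with (2 * gc (tent y) - 2 * gc (tent y)) by ring.
  apply (is_derive_minus (V := R_NormedModule) gc (tent_int gc)).
  + apply is_solution_is_derive; auto; destruct Hx; lra.
  + now apply is_derive_tent_int.
- intros y _; apply continuity_pt_filterlim.
  apply (continuous_Rminus gc (tent_int gc)); auto using continuous_tent_int.
- assert (E0 : gc 0 = 0).
  { unfold gc; rewrite clamp_id; auto; unfold unit_interval; lra. }
  assert (E1 : tent_int gc 0 = 0) by apply (RInt_point (V := R_CompleteNormedModule)).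
  rewrite E0, E1 in E; unfold gc in *; lra.
Qed.

Theorem theorem4 : forall A : R,
  exists f : R -> R,
    (is_solution f /\ f 0 = 0 /\ is_RInt f 0 1 A) /\
    (forall g : R -> R,
       is_solution g /\ g 0 = 0 /\ is_RInt g 0 1 A ->
       forall x : R, unit_interval x -> g x = f x).
Proof.
intros A; exists (tent_limit A).
assert (Hc := continuous_tent_limit A).
assert (HF := tent_limit_fixed A).
split; [split; [|split]|].
- now apply tent_int_fixed_is_solution.
- rewrite HF by (unfold unit_interval; lra).
  apply (RInt_point (V := R_CompleteNormedModule)).
- rewrite <- (RInt_tent_limit A) at 2.
  now apply (RInt_correct (V := R_CompleteNormedModule)), ex_RInt_cont.
- intros g [Hg [H0 HI]] x Hx.
  (* [g] is arbitrary outside [[0,1]], so uniqueness is applied to its continuous extension. *)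
  rewrite <- (clamp_id x Hx) at 1.
  apply (tent_int_fixed_point_unique (fun y => g (clamp y))); auto.
  + now apply is_solution_continuous.
  + rewrite RInt_comp_clamp, RInt_tent_limit.
    now apply (is_RInt_unique (V := R_CompleteNormedModule)).
  + now apply is_solution_fixed.
Qed.
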